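(* If the Principal selection mechanism $f$ has swap regret bounded by $\mathrm{SReg}(T)$ against any adaptive adversary, and the Principal provides a fixed linear contract $v_\alpha(r)=\alpha r$ (with $\alpha\in[0,1]$) in each round, then each Agent's expected cumulative payment over the $T$ rounds is at least $-\alpha\,\mathrm{SReg}(T)$.
   Context: Contracting model. There are $k$ Agents, $T$ rounds, outcomes $o_1,\dots,o_m$ with returns $r(o)\in[-1,1]$ to the Principal, and a set $\mathcal Y$ of states of nature. Actions are effort levels $a\in[0,1]$. The probability that outcome $o$ occurs when Agent $i$ exerts effort $a$ in state $y$ is $p_{i,o}(a,y)=m_{i,o,y}\,a+b_{i,o,y}\in[0,1]$ (affine in $a$), with $\sum_j p_{i,o_j}(a,y)=1$; this distribution is denoted $\mathcal D_{i,y,a}$. The randomness (seed) used to sample from it is denoted $\mathcal R_i$; fixing $a$, $y$, $\mathcal R_i$ fixes the outcome. The expected return is assumed non-decreasing in effort. Agent Selection Game with contract $v_\alpha$. The Principal fixes a selection mechanism $f=(f^t)_{t\le T}$: $f^t$ maps the Principal transcript $(i^s,r(o^s))_{s<t}$ and the Principal's round-$t$ random bits $\mathcal R^t$ to an element of $[k]\cup\{\emptyset\}$, where the outside option $\emptyset$ gives the Principal return $0$ at no cost. In round $t$: Agent $i^t$ is selected, takes action $a^t$, the state $y^t$ is revealed to the Agents, $o^t\sim\mathcal D_{i^t,y^t,a^t}$ is realized, the Principal receives $r(o^t)$ and Agent $i^t$ receives the payment $\alpha r(o^t)$ (possibly negative). Agents choose actions by policies mapping Agent transcripts $(y^s,\mathcal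 R^s_{i^s},\mathcal R^s,a^s)_{s<t}$ to distributions over $[0,1]$. The claim is for arbitrary Agent policies and state sequence $y^{1:T}$; Agent $i$'s cumulative payment is $\sum_{t:\,i^t=i}\alpha r(o^t)$, and the expectation is over the play. Swap regret. A selection mechanism is viewed as a bandit learning algorithm whose actions are the $k$ Agents and the outside option and whose losses are the negatives of the returns (loss $0$ for $\emptyset$). In each round $t$ an adaptive adversary picks a loss vector $\ell^t$ as a function of the transcript of the previous rounds (observed losses, selected actions, random bits used by the algorithm); the algorithm picks an action $s^t$ from this history and fresh randomness and observes only $\ell^t[s^t]$. Its swap regret is $\max_\chi\mathbb E[\sum_{t=1}^T(\ell^t[s^t]-\ell^t[\chi(s^t)])]$ over all maps $\chi$ from actions to actions. *)

(* Defs.v *)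
From HB Require Import structures.
From mathcomp Require Import all_boot all_order all_algebra.
From mathcomp Require Import all_classical all_reals all_analysis.
From mathcomp Require Import measurable_realfun.

Set Implicit Arguments.
Unset Strict Implicit.
Unset Printing Implicit Defensive.

Import Order.TTheory GRing.Theory Num.Theory.
Import numFieldNormedType.Exports.

Local Open Scope classical_set_scope.
Local Open Scope ring_scope.

(* Conventions. Rounds are numbered 0, 1, ..., T-1. All transcripts are tuples
   listing the most recent round first: an element of t.-tuple X is the record
   of the rounds t-1, ..., 0. Objects indexed by all rounds t : nat are only
   ever evaluated at t < T. *)

Section finite_choice.
Context d d' (T : measurableType d) (U : measurableType d').

Lemma measurable_fun_finite_case (F : finType) (c : T -> F) (g : F -> T -> U) :
  (forall a, measurable (c @^-1` [set a])) ->
  (forall a, measurable_fun setT (g a)) ->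
  measurable_fun setT (fun x => g (c x) x).
Proof.
move=> mc mg _ Y mY; rewrite setTI.
rewrite (_ : _ @^-1` Y =
    \bigcup_(a in [set: F]) (c @^-1` [set a] `&` g a @^-1` Y)); last first.
  apply/seteqP; split => x /=; first by move=> Yx; exists (c x).
  by move=> [a _ [/= <-]].
apply: fin_bigcup_measurable; first exact: finite_finset.
move=> a _; apply: measurableI => //.
by rewrite -[X in measurable X]setTI; exact: mg.
Qed.

End finite_choice.

Section probability_kernels.
Context d0 d1 d2 (T0 : measurableType d0) (T1 : measurableType d1)
  (T2 : measurableType d2) (R : realType).

Definition cst_kernel (P : probability T1 R) : R.-pker T0 ~> T1 :=
  kprobability (measurable_cst (P : pprobability T1 R)).

Variables (k1 : R.-pker T0 ~> T1) (k2 : R.-pker (T0 * T1)%type ~> T2).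

Definition pkproduct : T0 -> {measure set (T1 * T2) -> \bar R} :=
  mkproduct k1 k2.

HB.instance Definition _ := Kernel.on pkproduct.

Lemma pkproduct_setT x : pkproduct x setT = 1%E.
Proof.
rewrite -[LHS]/(kproduct k1 k2 x setT) /kproduct.
rewrite (eq_integral (cst 1%E)) => [|y _].
  by rewrite integral_cst// mul1e prob_kernel.
rewrite -[LHS]/(\int[k2 (x, y)]_z (\1_setT (y, z))%:E)%E.
rewrite (eq_integral (cst 1%E)) => [|z _]; last by rewrite indicT.
by rewrite integral_cst// mul1e prob_kernel.
Qed.

HB.instance Definition _ :=
  Kernel_isProbability.Build _ _ _ _ _ pkproduct pkproduct_setT.

End probability_kernels.

(* Law of a trajectory x_{n-1}, ..., x_0 in which x_t is drawn from the kernel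
   K t given the trajectory of the rounds before t (Ionescu-Tulcea, finite
   horizon). *)
Section trajectory_law.
Context d (X : measurableType d) (R : realType).

Section extend_law.
Variables (n : nat) (P : probability (n.-tuple X) R)
  (K : R.-pker (n.-tuple X) ~> X).

Definition extend_law (A : set (n.+1.-tuple X)) : \bar R :=
  (\int[P]_h K h [set x | A [tuple of x :: h]])%E.

Let measurable_extend : measurable_fun setT
  (fun hx : n.-tuple X * X => [tuple of hx.2 :: hx.1]).
Proof. exact: measurable_cons. Qed.

Let preE A (h : n.-tuple X) : [set x | A [tuple of x :: h]] =
  xsection ((fun hx : n.-tuple X * X => [tuple of hx.2 :: hx.1]) @^-1` A) h.
Proof. by apply/seteqP; split => x /=; rewrite /xsection/= inE. Qed.

Let mpre A : measurable A -> measurable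
  ((fun hx : n.-tuple X * X => [tuple of hx.2 :: hx.1]) @^-1` A).
Proof. by move=> mA; rewrite -[X in measurable X]setTI; exact: measurable_extend. Qed.

Let mpreh A (h : n.-tuple X) : measurable A ->
  measurable [set x | A [tuple of x :: h]].
Proof. by move=> mA; rewrite preE; apply: measurable_xsection; exact: mpre. Qed.

Let measurable_int A : measurable A ->
  measurable_fun setT (fun h => K h [set x | A [tuple of x :: h]]).
Proof.
move=> mA; under eq_fun do rewrite preE.
by apply: (measurable_fun_xsection_finite_kernel K); rewrite inE; exact: mpre.
Qed.

Let extend_law0 : extend_law set0 = 0%E.
Proof. by apply: integral0_eq => h _; rewrite (_ : [set _ | _] = set0). Qed.

Let extend_law_ge0 A : (0 <= extend_law A)%E.
Proof. by apply: integral_ge0. Qed.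

Let extend_law_sigma_additive : semi_sigma_additive extend_law.
Proof.
move=> F mF tF mUF.
rewrite [X in _ --> X](_ : _ = (\sum_(0 <= i <oo) extend_law (F i))%E).
  exact: is_cvg_ereal_nneg_natsum.
rewrite /extend_law -integral_nneseries//; last first.
  by move=> i; exact: measurable_int.
apply: eq_integral => h _.
rewrite -measure_semi_bigcup//.
- by move=> i; exact: mpreh.
- move=> i j _ _ [x [/= Fi Fj]].
  by apply: tF => //; exists [tuple of x :: h].
- exact: (mpreh h mUF).
Qed.

HB.instance Definition _ := isMeasure.Build _ _ _ extend_law
  extend_law0 extend_law_ge0 extend_law_sigma_additive.

Let extend_law_setT : extend_law setT = 1%E.
Proof.
rewrite /extend_law (eq_integral (cst 1%E)) => [|h _]; last exact: prob_kernel.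
by rewrite integral_cst// mul1e; exact: probability_setT.
Qed.

HB.instance Definition _ := Measure_isProbability.Build _ _ _
  extend_law extend_law_setT.

End extend_law.

Fixpoint trajectory_law (K : forall t, R.-pker (t.-tuple X) ~> X) (n : nat) :
    probability (n.-tuple X) R :=
  match n return probability (n.-tuple X) R with
  | 0 => \d_[tuple]
  | n'.+1 => extend_law (trajectory_law K n') (K n')
  end.

End trajectory_law.

(* The actions of the bandit learner: Some i is Agent i, None the outside
   option. *)
Definition arm (k : nat) := option 'I_k.

HB.instance Definition _ k := Finite.on (arm k).
HB.instance Definition _ k := isPointed.Build (arm k) None.
HB.instance Definition _ k := @isMeasurable.Build default_measure_display
  (arm k) discrete_measurable discrete_measurable0
  discrete_measurableC discrete_measurableU.

(* Agents 'I_k, outcomes 'I_m, states Y, seeds S. [sample i a y s] is the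
   outcome when Agent i exerts effort a in state y and the seed is s. *)
Record contracting_model (R : realType) (k m : nat) (Y : Type)
    (dS : measure_display) (S : measurableType dS) := ContractingModel {
  outcome_return : 'I_m -> R ;
  slope : 'I_k -> 'I_m -> Y -> R ;
  intercept : 'I_k -> 'I_m -> Y -> R ;
  seed_law : 'I_k -> probability S R ;
  sample : 'I_k -> R -> Y -> S -> 'I_m ;
  outcome_prob (i : 'I_k) (o : 'I_m) (a : R) (y : Y) : R :=
    slope i o y * a + intercept i o y ;
  outcome_return_bound : forall o, -1 <= outcome_return o <= 1 ;
  outcome_prob_itv : forall i o a y, 0 <= a <= 1 ->
    0 <= outcome_prob i o a y <= 1 ;
  outcome_prob_sum : forall i a y, 0 <= a <= 1 ->
    \sum_(o < m) outcome_prob i o a y = 1 ;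
  expected_return_mono : forall i y a a', 0 <= a -> a <= a' -> a' <= 1 ->
    \sum_(o < m) outcome_return o * outcome_prob i o a y <=
    \sum_(o < m) outcome_return o * outcome_prob i o a' y ;
  measurable_sample : forall i y o,
    measurable [set z : R * S | sample i z.1 y z.2 = o] ;
  sample_law : forall i o a y, 0 <= a <= 1 ->
    seed_law i [set s | sample i a y s = o] = (outcome_prob i o a y)%:E }.

(* A transcript entry of the Principal is (selected arm, return received).
   The random bits of distinct rounds are independent. *)
Record selection_mechanism (R : realType) (k : nat)
    (dB : measure_display) (B : measurableType dB) := SelectionMechanism {
  bits_law : nat -> probability B R ;
  select : forall t, t.-tuple (arm k * R) * B -> arm k ;
  measurable_select : forall t, measurable_fun setT (@select t) }.

(* [loss h] is the loss vector chosen in round t given the transcript h of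
   (selected arm, observed loss, random bits) of the previous rounds. Losses are
   negated returns, hence in [-1, 1], and 0 for the outside option. *)
Record adversary (R : realType) (k : nat)
    (dB : measure_display) (B : measurableType dB) := Adversary {
  loss : forall t, t.-tuple (arm k * R * B) -> arm k -> R ;
  measurable_loss : forall t a,
    measurable_fun setT (fun h => @loss t h a) ;
  loss_bound : forall t h a, -1 <= @loss t h a <= 1 ;
  loss_outside : forall t h, @loss t h None = 0 }.

Section swap_regret.
Context (R : realType) (k : nat) (dB : measure_display) (B : measurableType dB).
Variables (f : selection_mechanism R k B) (adv : adversary R k B).

(* An entry (a, l, b) records the arm selected, the full loss vector and the
   random bits of a round. *)
Definition observed (e : arm k * (arm k -> R) * B) :
    arm k * R * B := (e.1.1, e.1.2 e.1.1, e.2).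

Definition as_return (e : arm k * (arm k -> R) * B) :
    arm k * R := (e.1.1, - e.1.2 e.1.1).

Fixpoint bandit_run (t : nat) :
    t.-tuple B -> t.-tuple (arm k * (arm k -> R) * B) :=
  match t return t.-tuple B -> t.-tuple (arm k * (arm k -> R) * B) with
  | 0 => fun _ => [tuple]
  | t'.+1 => fun bs =>
      let h := bandit_run [tuple of behead bs] in
      let b := thead bs in
      [tuple of (select f ([tuple of map as_return h], b),
                 loss adv [tuple of map observed h], b) :: h]
  end.

Definition random_bits_law (T : nat) : probability (T.-tuple B) R :=
  trajectory_law (fun t => cst_kernel (t.-tuple B) (bits_law f t)) T.

Definition swap_regret (T : nat) : \bar R :=
  \big[maxe/-oo%E]_(chi : {ffun arm k -> arm k})
    'E_(random_bits_law T)[fun bs => (\sum_(s < T)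
       let: (a, l, _) := tnth (bandit_run bs) s in l a - l (chi a))%R]%E.

End swap_regret.

(* [effort t ys h] is the law of the effort in round t, given the states ys and
   the (random bits of the Principal, (effort, seed)) h of the previous rounds.
   States are kept apart from h because Y carries no sigma-algebra. *)
Record agent_policy (R : realType) (Y : Type) (dB dS : measure_display)
    (B : measurableType dB) (S : measurableType dS) := AgentPolicy {
  effort : forall t, t.-tuple Y ->
    R.-pker (t.-tuple (B * (R * S))) ~> R ;
  effort_itv : forall t (ys : t.-tuple Y) h, effort ys h `[0, 1]%classic = 1%E }.

Section agent_selection_game.
Context (R : realType) (k m : nat) (Y : Type) (dB dS : measure_display)
  (B : measurableType dB) (S : measurableType dS).
Variables (M : contracting_model R k m Y S) (f : selection_mechanism R k B)
  (pi : 'I_k -> agent_policy R Y B S) (y : nat -> Y).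

Let round : Type := (B * (R * S))%type.

Definition realized_return (t : nat) (c : arm k) (z : R * S) : R :=
  if c is Some i then outcome_return M (sample M i z.1 (y t) z.2) else 0.

Fixpoint principal_transcript (t : nat) :
    t.-tuple round -> t.-tuple (arm k * R) :=
  match t return t.-tuple round -> t.-tuple (arm k * R) with
  | 0 => fun _ => [tuple]
  | t'.+1 => fun h =>
      let p := principal_transcript [tuple of behead h] in
      let c := select f (p, (thead h).1) in
      [tuple of (c, realized_return t' c (thead h).2) :: p]
  end.

Lemma measurable_realized_return t c : measurable_fun setT (realized_return t c).
Proof.
case: c => [i|]; last exact: measurable_cst.
apply: (@measurable_fun_finite_case _ _ _ _ _ (fun z => sample M i z.1 (y t) z.2)
  (fun o _ => outcome_return M o)) => // o.
exact: measurable_sample.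
Qed.

Lemma measurable_arm_case d d' (T : measurableType d) (U : measurableType d')
    (c : T -> arm k) (g : arm k -> T -> U) :
  measurable_fun setT c -> (forall a, measurable_fun setT (g a)) ->
  measurable_fun setT (fun x => g (c x) x).
Proof.
move=> mc mg; apply: measurable_fun_finite_case => // a.
by rewrite -[X in measurable X]setTI; exact: mc.
Qed.

Lemma measurable_principal_transcript t :
  measurable_fun setT (@principal_transcript t).
Proof.
elim: t => [|t IH]; first exact: measurable_cst.
have mp : measurable_fun setT
    (fun h : t.+1.-tuple round => principal_transcript [tuple of behead h]).
  by apply: measurableT_comp IH _; exact: measurable_behead.
have mth : measurable_fun setT (fun h : t.+1.-tuple round => thead h).
  exact: measurable_tnth.
have mc : measurable_fun setT (fun h : t.+1.-tuple round =>
    select f (principal_transcript [tuple of behead h], (thead h).1)).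
  apply: measurableT_comp (measurable_select f (t := t)) _.
  by apply: measurable_fun_pair => //; exact: measurableT_comp.
apply: measurable_cons => //; apply: measurable_fun_pair => //=.
apply: (measurable_arm_case
  (g := fun c (h : t.+1.-tuple round) => realized_return t c (thead h).2)) => // c.
apply: measurableT_comp (measurable_realized_return t c) _.
exact: measurableT_comp.
Qed.

Section round_kernel.
Variable t : nat.

(* When the outside option is selected nobody acts and no seed is drawn; the
   slot of the transcript then holds a fixed dummy value. *)
Definition action_kernel_of (c : arm k) : R.-pker (t.-tuple round) ~> (R * S)%type :=
  match c with
  | Some i => pkproduct (effort (pi i) [tuple y (rev_ord s) | s < t])
                        (cst_kernel _ (seed_law M i))
  | None => cst_kernel _ (@dirac _ (R * S)%type (0, point) R)
  end.

Definition action_kernel (hb : t.-tuple round * B) :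
    {measure set (R * S) -> \bar R} :=
  action_kernel_of (select f (principal_transcript hb.1, hb.2)) hb.1.

Lemma measurable_action_kernel U : measurable U ->
  measurable_fun setT (action_kernel ^~ U).
Proof.
move=> mU; apply: (measurable_arm_case
  (g := fun c (hb : t.-tuple round * B) => action_kernel_of c hb.1 U)) => [|c].
  apply: measurableT_comp (measurable_select f (t := t)) _.
  apply: measurable_fun_pair => //.
  exact: measurableT_comp (@measurable_principal_transcript t) _.
by apply: measurableT_comp (measurable_kernel (action_kernel_of c) U mU) _.
Qed.

HB.instance Definition _ :=
  isKernel.Build _ _ _ _ _ action_kernel measurable_action_kernel.

Lemma action_kernel_setT hb : action_kernel hb setT = 1%E.
Proof. exact: prob_kernel. Qed.

HB.instance Definition _ :=
  Kernel_isProbability.Build _ _ _ _ _ action_kernel action_kernel_setT.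

Definition round_kernel : R.-pker (t.-tuple round) ~> round :=
  pkproduct (cst_kernel _ (bits_law f t)) action_kernel.

End round_kernel.

Definition play_law (T : nat) : probability (T.-tuple round) R :=
  trajectory_law round_kernel T.

Definition linear_contract (alpha r : R) : R := alpha * r.

Definition cumulative_payment (alpha : R) (i : 'I_k) (T : nat)
    (h : T.-tuple round) : R :=
  \sum_(s < T | (tnth (principal_transcript h) s).1 == Some i)
    linear_contract alpha (tnth (principal_transcript h) s).2.

End agent_selection_game.

(* Main.v *)
From HB Require Import structures.
Require Import Defs.
From mathcomp Require Import all_boot all_order all_algebra.
From mathcomp Require Import all_classical all_reals all_analysis.
From mathcomp Require Import measurable_realfun lra.

Import Order.TTheory GRing.Theory Num.Theory.
Local Open Scope classical_set_scope.
Local Open Scope ring_scope.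

(* Once the private randomness of the Agents (efforts and seeds) is fixed, their
   behaviour is a deterministic function of the random bits of the Principal,
   hence an adaptive adversary, and the swap regret for the map sending Agent i
   to the outside option and fixing the other arms is minus the cumulative
   return of Agent i. It remains to average over the private randomness. An
   effort law on [0, 1] is the image of the uniform law under its quantile
   function, jointly measurable in the history, so the response of an Agent in
   a round is a measurable function of the history and of a noise independent of
   it. The noises are averaged out one (round, Agent) pair at a time, each time
   by Tonelli: a bound valid for every value of the noise survives. *)

(** * Integration against kernels *)

Section mixture.
Context {d0 d d1 d2 d3} {U : measurableType d0} {V : measurableType d}
  {X : measurableType d1} {Y : measurableType d2} {Z : measurableType d3}
  {R : realType}.
Variables (l : R.-pker U ~> V) (K : R.-pker X ~> Y) (p : U * V -> X)
  (phi : X * Y -> Z).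
Hypotheses (mp : measurable_fun setT p) (mphi : measurable_fun setT phi).

(** The law of [phi (p w, y)] for [y] drawn from [K (p w)]. As a kernel it can be composed with [l],
    which turns a mixture into a kernel composition. *)
Definition image_kernel (w : U * V) : set Z -> \bar R :=
  pushforward (K (p w)) (fun y => phi (p w, y)).

Let mphi2 x : measurable_fun setT (fun y => phi (x, y)).
Proof. exact: measurableT_comp mphi (measurable_pair1 x). Qed.

Let image_kernel0 w : image_kernel w set0 = 0%E.
Proof. by rewrite /image_kernel /pushforward preimage_set0 measure0. Qed.

Let image_kernel_ge0 w A : (0 <= image_kernel w A)%E.
Proof. exact: measure_ge0. Qed.

Let image_kernel_sigma_additive w : semi_sigma_additive (image_kernel w).
Proof.
move=> F mF tF mUF; rewrite /image_kernel /pushforward preimage_bigcup.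
apply: measure_semi_sigma_additive.
- by move=> n; rewrite -[X in measurable X]setTI; exact: mphi2.
- apply/trivIsetP => /= i j _ _ ij; rewrite -preimage_setI.
  by move/trivIsetP : tF => /(_ _ _ _ _ ij) ->//; rewrite preimage_set0.
- by rewrite -preimage_bigcup -[X in measurable X]setTI; exact: mphi2.
Qed.

HB.instance Definition _ w := isMeasure.Build _ _ _ (image_kernel w)
  (image_kernel0 w) (image_kernel_ge0 w) (@image_kernel_sigma_additive w).

Definition image_kernel_meas : U * V -> {measure set Z -> \bar R} :=
  image_kernel.

Let measurable_image_kernel A : measurable A ->
  measurable_fun setT (image_kernel_meas ^~ A).
Proof.
move=> mA.
have mphiA : measurable (phi @^-1` A).
  by rewrite -[X in measurable X]setTI; exact: mphi.
rewrite (_ : _ ^~ A = (fun x => K x (xsection (phi @^-1` A) x)) \o p).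
  apply: measurableT_comp mp => //.
  by apply: (measurable_fun_xsection_finite_kernel K); rewrite inE.
apply/funext => w /=; congr (K _ _).
by apply/seteqP; split => y /=; rewrite /xsection/= inE.
Qed.

HB.instance Definition _ := isKernel.Build _ _ _ _ _
  image_kernel_meas measurable_image_kernel.

Let image_kernel_setT w : image_kernel_meas w setT = 1%E.
Proof. exact: prob_kernel. Qed.

HB.instance Definition _ := Kernel_isProbability.Build _ _ _ _ _
  image_kernel_meas image_kernel_setT.

(** [nu] agrees on measurable sets with the composition of [l] and the image kernel, so integrals
    follow from those of kernel compositions and of pushforwards. Both [extend_law] and [pkproduct]
    are instances. *)
Lemma ge0_integral_mixture u (nu : {measure set Z -> \bar R}) (f : Z -> \bar R) :
  (forall A, measurable A -> nu A =
    \int[l u]_v K (p (u, v)) [set y | A (phi (p (u, v), y))])%E ->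
  (forall z, 0 <= f z)%E -> measurable_fun setT f ->
  (\int[nu]_z f z =
   \int[l u]_v \int[K (p (u, v))]_y f (phi (p (u, v), y)))%E.
Proof.
move=> nuE f0 mf.
rewrite (eq_measure_integral (mkcomp l image_kernel_meas u)).
  rewrite integral_kcomp//; apply: eq_integral => v _.
  rewrite -[LHS]/(integral (pushforward (K (p (u, v))) _) _ _).
  by rewrite ge0_integral_pushforward.
by move=> A mA _; exact: nuE.
Qed.

End mixture.

Section integrals.
Context {R : realType}.

Lemma ge0_integral_extend_law {d} {X : measurableType d} {n}
    (P : probability (n.-tuple X) R) (K : R.-pker (n.-tuple X) ~> X)
    (g : n.+1.-tuple X -> \bar R) :
  (forall h, 0 <= g h)%E -> measurable_fun setT g ->
  (\int[extend_law P K]_h g h =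
   \int[P]_h \int[K h]_x g [tuple of x :: h])%E.
Proof.
move=> g0 mg.
(* [extend_law] carries no parameter, so the outer kernel is [P] over the one-point space. *)
apply: (ge0_integral_mixture (cst_kernel unit P) K snd
  (fun hx => [tuple of hx.2 :: hx.1]) _ _ tt) => //.
exact: measurable_cons.
Qed.

Lemma ge0_integral_pkproduct {d0 d1 d2} {X : measurableType d0}
    {Y : measurableType d1} {Z : measurableType d2}
    (K1 : R.-pker X ~> Y) (K2 : R.-pker (X * Y)%type ~> Z) x
    (g : Y * Z -> \bar R) :
  (forall z, 0 <= g z)%E -> measurable_fun setT g ->
  (\int[pkproduct K1 K2 x]_z g z = \int[K1 x]_y \int[K2 (x, y)]_z g (y, z))%E.
Proof.
move=> g0 mg.
apply: (ge0_integral_mixture K1 K2 id (fun w => (w.1.2, w.2)) _ _ x) => //.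
  by apply: measurable_fun_pair => //; exact: measurableT_comp.
move=> A mA; apply: eq_integral => y _.
rewrite -[LHS]/(\int[K2 (x, y)]_z (\1_[set z | A (y, z)] z)%:E)%E.
rewrite integral_indic ?setIT//.
rewrite -[X in measurable X]setTI.
exact: (measurable_pair1 y).
Qed.

Lemma ge0_integral_randomization {d1 d2} {W : measurableType d1}
    {Z : measurableType d2} (mu : probability W R)
    (K : {measure set Z -> \bar R}) (G : W -> Z) (g : Z -> \bar R) :
  measurable_fun setT G ->
  (forall A, measurable A -> K A = mu (G @^-1` A)) ->
  (forall z, 0 <= g z)%E -> measurable_fun setT g ->
  (\int[K]_z g z = \int[mu]_w g (G w))%E.
Proof.
move=> mG KE g0 mg.
rewrite (eq_measure_integral (pushforward mu G)); last by move=> A mA _; exact: KE.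
by rewrite ge0_integral_pushforward.
Qed.

End integrals.

(** * Quantile functions *)

Section quantile.
Context {R : realType} {d} {X : measurableType d}.
Variable K : R.-pker X ~> R.
Hypothesis K01 : forall h, K h `[0, 1]%classic = 1%E.

(* Quantile function of [K h] written through the survival function, so that
   [quantile_gt] needs only continuity from below; [x = 0] keeps the set
   nonempty. *)
Definition quantile (z : X * R) : R :=
  sup [set x : R | 0 <= x <= 1 /\ (x = 0 \/ (z.2%:E < K z.1 `]x, +oo[%classic)%E)].

Let set_quantile_ubound z :
  ubound [set x : R | 0 <= x <= 1 /\ (x = 0 \/ (z.2%:E < K z.1 `]x, +oo[%classic)%E)] 1.
Proof. by move=> x [/andP[]]. Qed.

Let set_quantile0 z :
  [set x : R | 0 <= x <= 1 /\ (x = 0 \/ (z.2%:E < K z.1 `]x, +oo[%classic)%E)] 0.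
Proof. by split; [rewrite lexx ler01|left]. Qed.

Lemma quantile_itv z : 0 <= quantile z <= 1.
Proof.
apply/andP; split.
  by apply: ub_le_sup (set_quantile0 z); exists 1; exact: set_quantile_ubound.
by apply: ge_sup (set_quantile_ubound z); exists 0.
Qed.

(** From left to right, an element of the set above [x] has a smaller open ray. The converse needs
    some slack above [x], which continuity from below of the measure provides. *)
Lemma quantile_gt z (x : R) : 0 <= x < 1 ->
  (x < quantile z) = (z.2%:E < K z.1 `]x, +oo[%classic)%E.
Proof.
move=> /andP[x0 x1]; apply/idP/idP => [xq|zK].
  have [|y [_ [y0|zK]] xy] := sup_gt _ xq; first by exists 0.
    by move: xy; rewrite y0 ltNge x0.
  apply: (lt_le_trans zK); apply: le_measure; rewrite ?inE//.
  by apply: subset_itvr; rewrite bnd_simp ltW.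
(* The open ray at [x] is the increasing union of these closed rays; if all their masses were at
   most [z.2], so would be the limit. *)
have [n zKn] : exists n, (z.2%:E < K z.1 `[(x + n.+1%:R^-1)%R, +oo[%classic)%E.
  apply/not_existsP => Kz; move: zK; rewrite itvoyEbigcup; apply/negP.
  rewrite -leNgt.
  have cK : (K z.1 `[(x + n.+1%:R^-1)%R, +oo[%classic @[n --> \oo] -->
      K z.1 (\bigcup_n `[(x + n.+1%:R^-1)%R, +oo[%classic))%E.
    apply: nondecreasing_cvg_mu => //.
      exact: bigcup_measurable.
    move=> m n mn; apply/subsetPset; apply: subset_itvr.
    by rewrite bnd_simp lerD2l lef_pV2 ?posrE// ler_nat.
  rewrite -(cvg_lim _ cK)//; apply: lime_le; first by apply/cvg_ex; eexists; exact: cK.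
  by apply: nearW => n; rewrite leNgt; apply/negP; exact: Kz.
(* Truncation at 1 keeps candidates in the unit interval. The midpoint of [x] and [y] is above [x]
   and strictly below [x + n.+1%:R^-1], so its open ray contains the closed ray of [zKn] and it
   belongs to the set defining the quantile. *)
pose y : R := Num.min (x + n.+1%:R^-1) 1.
have xy : x < y by rewrite lt_min x1 ltrDl invr_gt0 ltr0n.
have y1 : y <= 1 by rewrite ge_min lexx orbT.
have yn : y <= x + n.+1%:R^-1 by rewrite ge_min lexx.
move: y xy y1 yn => y xy y1 yn.
apply: (@lt_le_trans _ _ ((x + y) / 2)); first lra.
apply: ub_le_sup; first by exists 1; exact: set_quantile_ubound.
split; first lra.
right; apply: (lt_le_trans zKn); apply: le_measure; rewrite ?inE//.
by apply: subset_itvr; rewrite bnd_simp; apply: (@lt_le_trans _ _ y) => //; lra.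
Qed.

Lemma quantile_itv_ge1 z (x : R) : 1 <= x -> (x < quantile z) = false.
Proof.
by move=> x1; apply/negbTE; rewrite -leNgt (le_trans _ x1)//; case/andP: (quantile_itv z).
Qed.

Lemma quantile_itv_lt0 z (x : R) : x < 0 -> x < quantile z.
Proof. by move=> x0; rewrite (lt_le_trans x0)//; case/andP: (quantile_itv z). Qed.

(** By [quantile_gt] the superlevel sets compare two measurable functions of history and noise;
    levels outside the unit interval give the full or the empty set. *)
Lemma measurable_quantile : measurable_fun setT quantile.
Proof.
apply: (measurability _ (RGenOInfty.measurableE R)).
move=> _ [_ [x ->] <-]; rewrite setTI preimage_itvoy.
have [x0|x0] := ltP x 0.
  rewrite (_ : [set _ | _] = setT)//; apply/seteqP; split => z//= _.
  exact: quantile_itv_lt0.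
have [x1|x1] := ltP x 1; last first.
  rewrite (_ : [set _ | _] = set0)//; apply/seteqP; split => z//=.
  by rewrite quantile_itv_ge1.
rewrite (_ : [set _ | _] = [set z | (z.2%:E < K z.1 `]x, +oo[%classic)%E]); last first.
  by apply/seteqP; split => z /=; rewrite quantile_gt ?x0.
rewrite -[X in measurable X]setTI; apply: measurable_lte => //.
  by apply/measurable_EFinP; exact: measurable_snd.
apply: (@measurableT_comp _ _ _ _ _ _ (K ^~ `]x, +oo[%classic) _ fst) => //.
exact: measurable_kernel.
Qed.

Lemma uniform_prob_lt (s : R) : 0 <= s <= 1 ->
  uniform_prob (@ltr01 R) [set u | u < s] = s%:E.
Proof.
move=> /andP[s0 s1].
rewrite -set_itvNyo /uniform_prob integral_uniform_pdf.
rewrite (_ : _ `&` _ = `[0, s[%classic); last first.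
  apply/seteqP; split => u /=; rewrite !in_itv/=; first by move=> [-> /andP[->]].
  by move=> /andP[u0 us]; split => //; rewrite u0/= ltW// (lt_le_trans us).
rewrite (eq_integral (cst 1%E)); last first.
  move=> u; rewrite inE/= in_itv/= => /andP[u0 us].
  by rewrite /uniform_pdf u0 ltW ?(lt_le_trans us)// subr0 invr1.
rewrite integral_cst//= mul1e lebesgue_measure_itv/= lte_fin.
case: ltP => [_|s0']; first by rewrite oppr0 adde0.
by congr EFin; apply/le_anti; rewrite s0.
Qed.

(** Open rays form a generating family closed under intersection, so agreement on them is enough;
    there [quantile_gt] reduces the claim to the uniform mass below a level. [K01] settles the rays
    starting outside [[0, 1[]. *)
Lemma quantile_law h A : measurable A ->
  K h A = uniform_prob (@ltr01 R) [set u | A (quantile (h, u))].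
Proof.
have mq : measurable_fun setT (fun u => quantile (h, u)).
  exact: measurableT_comp measurable_quantile (measurable_pair1 h).
move: A; apply: (measure_unique (@RGenOInfty.G R) (fun n => `](- n%:R), +oo[%classic)
  (RGenOInfty.measurableE R) _ _ _ (K h)
  (pushforward (uniform_prob (@ltr01 R)) (fun u => quantile (h, u)))).
- move=> _ _ [x ->] [y ->]; exists (Num.max x y).
  by apply/seteqP; split => z /=; rewrite !in_itv/= !andbT gt_max => /andP.
- by move=> n; exists (- n%:R).
- apply/seteqP; split => // x _; exists (Num.bound x) => //=.
  by rewrite in_itv/= andbT ltrNl; exact: unstable.ltrNbound.
- move=> _ [x ->].
  transitivity (uniform_prob (@ltr01 R) [set u | x < quantile (h, u)]); last first.
    congr (uniform_prob _ _).
    by apply/seteqP; split => u; rewrite /= in_itv/= andbT.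
  have K1 : K h setT = 1%E by exact: prob_kernel.
  have [x0|x0] := ltP x 0.
    rewrite (_ : [set u | x < quantile (h, u)] = setT); last first.
      by apply/seteqP; split => z//= _; exact: quantile_itv_lt0.
    rewrite probability_setT; apply/eqP; rewrite eq_le; apply/andP; split.
      by rewrite -K1; apply: le_measure; rewrite ?inE.
    rewrite -(K01 h); apply: le_measure; rewrite ?inE//.
    by apply: subset_itv; rewrite bnd_simp.
  have [x1|x1] := ltP x 1; last first.
    rewrite (_ : [set u | x < quantile (h, u)] = set0); last first.
      by apply/seteqP; split => z//=; rewrite quantile_itv_ge1.
    rewrite measure0; apply/eqP; rewrite eq_le measure_ge0 andbT.
    (* The ray is disjoint from the unit interval, which already has mass 1; adding that mass to
       both sides leaves a bound by the total mass. *)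
    rewrite -(@leeD2lE _ 1%E)// adde0 -{1}(K01 h) -measureU//.
    - by rewrite -K1; apply: le_measure; rewrite ?inE//; exact: measurableU.
    - apply/seteqP; split => z//= []; rewrite !in_itv/= andbT => /andP[_ z1].
      by rewrite ltNge (le_trans z1).
  have Kfin : K h `]x, +oo[%classic \is a fin_num.
    rewrite ge0_fin_numE// (@le_lt_trans _ _ 1%E) ?ltry//.
    by rewrite -K1; apply: le_measure; rewrite ?inE.
  rewrite (_ : [set u | x < quantile (h, u)] =
      [set u | u < fine (K h `]x, +oo[%classic)]); last first.
    by apply/seteqP; split => z /=; rewrite quantile_gt ?x0//= -lte_fin fineK.
  rewrite uniform_prob_lt ?fineK// fine_ge0//= -lee_fin fineK// -K1.
  by apply: le_measure; rewrite ?inE.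
- move=> n; rewrite (@le_lt_trans _ _ 1%E) ?ltry//.
  by rewrite -(@prob_kernel _ _ _ _ _ K h); apply: le_measure; rewrite ?inE.
Qed.

End quantile.

(** * Games between a mechanism and randomized behaviours *)

Section probability_integrals.
Import HBNNSimple.

Lemma integral_probability_cst {d} {W : measurableType d} {R : realType}
    (mu : probability W R) (C : \bar R) : (\int[mu]_w C = C)%E.
Proof.
rewrite -[LHS]/(\int[mu]_w cst C w)%E integral_cst//.
by rewrite [X in (_ * X)%E](_ : _ = 1%E) ?mule1//; exact: probability_setT.
Qed.

(** The integral is a supremum over simple functions below [phi], each at most [C]. This covers an
    arbitrary [phi], such as the value of a game as a function of one noise. *)
Lemma ge0_integral_le_cst {d} {W : measurableType d} {R : realType}
    (mu : probability W R) (phi : W -> \bar R) (C : \bar R) :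
  (forall w, 0 <= phi w <= C)%E -> (\int[mu]_w phi w <= C)%E.
Proof.
move=> phiC; rewrite ge0_integralTE; last by move=> w; case/andP: (phiC w).
apply: ge_ereal_sup => _ [h /= hphi <-].
rewrite -integralT_nnsfun.
apply: (@le_trans _ _ (\int[mu]_w cst C w)%E).
  apply: ge0_le_integral => //.
  - by move=> w _; rewrite lee_fin; exact: fun_ge0.
  - exact/measurable_EFinP.
  - by move=> w _; apply: (le_trans (hphi w)); case/andP: (phiC w).
by rewrite integral_probability_cst.
Qed.

End probability_integrals.

Lemma measurable_prepend {d} {X : measurableType d} {n} (A : set (n.+1.-tuple X))
    (h : n.-tuple X) : measurable A -> measurable [set x | A [tuple of x :: h]].
Proof.
move=> mA; rewrite -[X in measurable X]setTI.
by apply: (measurable_cons (f := id) (g := cst h)).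
Qed.

Lemma trajectory_law_ext {d} {X : measurableType d} {R : realType}
    (K K' : forall t, R.-pker (t.-tuple X) ~> X) n :
  (forall t h U, (t < n)%N -> measurable U -> K t h U = K' t h U) ->
  forall A, measurable A -> trajectory_law K n A = trajectory_law K' n A.
Proof.
elim: n => [//|n IHn] KK' A mA.
rewrite -[LHS]/(\int[trajectory_law K n]_h K n h [set x | A [tuple of x :: h]])%E.
rewrite (eq_measure_integral (trajectory_law K' n)); last first.
  by move=> B mB _; apply: IHn => // t h U tn; apply: KK'; rewrite ltnS ltnW.
by apply: eq_integral => h _; apply: KK' => //; exact: measurable_prepend.
Qed.

Section game.
Context {R : realType} {k m : nat} {Y : Type} {dB dS : measure_display}
  {B : measurableType dB} {S : measurableType dS}.
Variables (M : contracting_model R k m Y S) (f : selection_mechanism R k B)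
  (y : nat -> Y).

Local Notation round := (B * (R * S))%type.
(** The law of the (effort, seed) pair for each round and selected arm, given the history. The
    actual play, the deterministic play and the hybrids between them are all games of this form. *)
Local Notation behavior :=
  (forall t, arm k -> R.-pker t.-tuple round ~> (R * S)%type).

Definition selected {t} (hb : t.-tuple round * B) : arm k :=
  select f (principal_transcript M f y hb.1, hb.2).

Lemma measurable_selected t : measurable_fun setT (@selected t).
Proof.
apply: measurableT_comp (measurable_select f (t := t)) _.
apply: measurable_fun_pair => //.
exact: measurableT_comp (measurable_principal_transcript M f y (t := t)) _.
Qed.

Section behavior_kernel.
Variables (A : behavior) (t : nat).

Definition behavior_kernel (hb : t.-tuple round * B) :
    {measure set (R * S) -> \bar R} := A t (selected hb) hb.1.

Let measurable_behavior_kernel U : measurable U ->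
  measurable_fun setT (behavior_kernel ^~ U).
Proof.
move=> mU; apply: (measurable_arm_case
  (g := fun c (hb : t.-tuple round * B) => A t c hb.1 U)) => [|c].
  exact: measurable_selected.
by apply: measurableT_comp (measurable_kernel (A t c) U mU) _.
Qed.

HB.instance Definition _ :=
  isKernel.Build _ _ _ _ _ behavior_kernel measurable_behavior_kernel.

Let behavior_kernel_setT hb : behavior_kernel hb setT = 1%E.
Proof. exact: prob_kernel. Qed.

HB.instance Definition _ :=
  Kernel_isProbability.Build _ _ _ _ _ behavior_kernel behavior_kernel_setT.

Definition game_kernel : R.-pker t.-tuple round ~> round :=
  pkproduct (cst_kernel _ (bits_law f t)) behavior_kernel.

Lemma ge0_integral_game_kernel h (g : round -> \bar R) :
  (forall r, 0 <= g r)%E -> measurable_fun setT g ->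
  (\int[game_kernel h]_r g r =
   \int[bits_law f t]_b \int[A t (selected (h, b)) h]_z g (b, z))%E.
Proof.
exact: (@ge0_integral_pkproduct _ _ _ _ _ _ _ (cst_kernel _ _) behavior_kernel).
Qed.

Lemma measurable_integral_game_kernel (g : t.+1.-tuple round -> \bar R) :
  (forall h, 0 <= g h)%E -> measurable_fun setT g ->
  measurable_fun setT (fun h => \int[game_kernel h]_r g [tuple of r :: h])%E.
Proof.
move=> g0 mg; apply: (measurable_fun_integral_finite_kernel
  (fun hr : t.-tuple round * round => g [tuple of hr.2 :: hr.1]) game_kernel) => //.
apply: measurableT_comp mg _; exact: measurable_cons.
Qed.

End behavior_kernel.

Definition game_law (A : behavior) (n : nat) : probability (n.-tuple round) R :=
  trajectory_law (game_kernel A) n.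

Lemma ge0_integral_game_lawS A {n} {g : n.+1.-tuple round -> \bar R} :
  (forall h, 0 <= g h)%E -> measurable_fun setT g ->
  (\int[game_law A n.+1]_h g h =
   \int[game_law A n]_h \int[game_kernel A n h]_r g [tuple of r :: h])%E.
Proof. by move=> g0 mg; rewrite -ge0_integral_extend_law. Qed.

Lemma game_kernel_ext (A A' : behavior) t h U :
  (forall c V, measurable V -> A t c h V = A' t c h V) -> measurable U ->
  game_kernel A t h U = game_kernel A' t h U.
Proof.
move=> AA' mU; apply: eq_integral => b _.
by apply: eq_measure_integral => V mV _; exact: AA'.
Qed.

Lemma game_law_ext (A A' : behavior) n :
  (forall t c h U, (t < n)%N -> measurable U -> A t c h U = A' t c h U) ->
  forall U, measurable U -> game_law A n U = game_law A' n U.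
Proof.
move=> AA'; apply: trajectory_law_ext => t h U tn mU.
by apply: game_kernel_ext => // c V mV; exact: AA'.
Qed.

(** * Averaging out the noise of one Agent in one round *)

Section randomize_one.
Context {d : measure_display} {W : measurableType d}.
Variables (mu : probability W R) (A : behavior) (A' : W -> behavior)
  (j : nat) (l : 'I_k) (G : j.-tuple round * W -> R * S).
Hypothesis mG : measurable_fun setT G.
Hypothesis AG : forall h U, measurable U ->
  A j (Some l) h U = mu [set w | U (G (h, w))].
Hypothesis A'G : forall w h U, measurable U ->
  A' w j (Some l) h U = \d_(G (h, w)) U.
Hypothesis AA' : forall w t c h U, (t, c) != (j, Some l) -> measurable U ->
  A' w t c h U = A t c h U.

(** The value of round [j] given history, bits and noise. Gathering both cases in one jointly
    measurable function is what allows Tonelli; the noise enters only when Agent [l] is selected. *)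
Let play_round (g : j.+1.-tuple round -> \bar R) (z : j.-tuple round * B * W) :=
  (if selected z.1 == Some l then g [tuple of (z.1.2, G (z.1.1, z.2)) :: z.1.1]
   else \int[behavior_kernel A j z.1]_a g [tuple of (z.1.2, a) :: z.1.1])%E.

Let play_round_ge0 g : (forall h, 0 <= g h)%E -> forall z, (0 <= play_round g z)%E.
Proof. by move=> g0 z; rewrite /play_round; case: ifP => // _; exact: integral_ge0. Qed.

Let measurable_play_round g : (forall h, 0 <= g h)%E -> measurable_fun setT g ->
  measurable_fun setT (play_round g).
Proof.
move=> g0 mg; apply: (measurable_arm_case (c := @selected j \o fst)
  (g := fun c z => if c == Some l then g [tuple of (z.1.2, G (z.1.1, z.2)) :: z.1.1]
   else \int[behavior_kernel A j z.1]_a g [tuple of (z.1.2, a) :: z.1.1])%E).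
  by apply: measurableT_comp (@measurable_selected j) _.
move=> c; case: (c == Some l).
  apply: measurableT_comp mg _; apply: measurable_cons.
    apply: measurable_fun_pair; first exact: measurableT_comp.
    apply: measurableT_comp mG _; apply: measurable_fun_pair => //.
    exact: measurableT_comp.
  exact: measurableT_comp.
apply: (@measurableT_comp _ _ _ _ _ _
  (fun hb : j.-tuple round * B =>
     \int[behavior_kernel A j hb]_a g [tuple of (hb.2, a) :: hb.1])%E _ fst) => //.
apply: (measurable_fun_integral_finite_kernel
  (fun hba : (j.-tuple round * B) * (R * S) =>
     g [tuple of (hba.1.2, hba.2) :: hba.1.1]) (behavior_kernel A j)) => //.
apply: measurableT_comp mg _; apply: measurable_cons.
  by apply: measurable_fun_pair => //; exact: measurableT_comp.
exact: measurableT_comp.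
Qed.

Let play_round_eq g h b w : selected (h, b) = Some l ->
  play_round g (h, b, w) = g [tuple of (b, G (h, w)) :: h].
Proof. by move=> cl; rewrite /play_round cl eqxx. Qed.

Let play_round_neq g h b w : selected (h, b) != Some l ->
  (play_round g (h, b, w) =
   \int[A j (selected (h, b)) h]_a g [tuple of (b, a) :: h])%E.
Proof. by move=> cl; rewrite /play_round (negbTE cl). Qed.

(** Up to round [j] the law of the history does not depend on [w]. In round [j] Tonelli exchanges
    [w] with the history and the bits, and averaging the Dirac responses gives back the law in [A].
    The other rounds have common kernels. *)
Lemma integral_game_randomize n (g : n.-tuple round -> \bar R) :
  (forall h, 0 <= g h)%E -> measurable_fun setT g ->
  (\int[game_law A n]_h g h = \int[mu]_w \int[game_law (A' w) n]_h g h)%E.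
Proof.
elim: n g => [|n IHn] g g0 mg.
  rewrite [RHS](eq_integral (cst (\int[game_law A 0]_h g h)%E)) => [|w _].
    by rewrite integral_probability_cst.
  exact: eq_measure_integral.
rewrite ge0_integral_game_lawS//.
have mgh (h : n.-tuple round) :
    measurable_fun setT (fun r : round => g [tuple of r :: h]).
  apply: measurableT_comp mg _; exact: measurable_cons.
have [nj|nj] := eqVneq n j; last first.
  (* The last round is not round [j], so its kernel is the same for every [w] and is absorbed into
     the integrand of the induction hypothesis. *)
  rewrite IHn//; last 2 first.
  - by move=> h; exact: integral_ge0.
  - exact: measurable_integral_game_kernel.
  apply: eq_integral => w _.
  rewrite (ge0_integral_game_lawS (A' w) g0 mg).
  apply: eq_integral => h _; apply: eq_measure_integral => U mU _.
  by apply: game_kernel_ext => // c V mV; rewrite AA'// xpair_eqE (negbTE nj).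
move: g g0 mg mgh IHn; rewrite nj => g g0 mg mgh _.
have lawE w : forall U, measurable U -> game_law (A' w) j U = game_law A j U.
  apply: game_law_ext => t c h U tj mU; rewrite AA'// xpair_eqE.
  by rewrite (ltn_eqF tj).
have mF := measurable_play_round _ g0 mg; have F0 := play_round_ge0 _ g0.
(* With [w] innermost it plays the part of the randomness of Agent [l]; if another arm is selected
   the integrand is constant in [w]. *)
transitivity (\int[game_law A j]_h \int[bits_law f j]_b \int[mu]_w
    play_round g (h, b, w))%E.
  apply: eq_integral => h _; rewrite ge0_integral_game_kernel//.
  apply: eq_integral => b _.
  have [cl|cl] := eqVneq (selected (h, b)) (Some l); last first.
    rewrite [RHS](eq_integral (cst (\int[A j (selected (h, b)) h]_a
      g [tuple of (b, a) :: h])%E)) => [|w _]; last by rewrite play_round_neq.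
    by rewrite integral_probability_cst.
  rewrite [RHS](eq_integral (fun w => g [tuple of (b, G (h, w)) :: h])) => [|w _];
    last by rewrite play_round_eq.
  rewrite cl; apply: (ge0_integral_randomization mu _ (fun w => G (h, w))) => //.
  - exact: measurableT_comp mG (measurable_pair1 h).
  - by move=> V mV; rewrite AG.
  - apply: measurableT_comp (mgh h) _; exact: measurable_pair1.
(* Tonelli twice: [w] moves out past the bits, then past the history. *)
transitivity (\int[mu]_w \int[game_law A j]_h \int[bits_law f j]_b
    play_round g (h, b, w))%E.
  under eq_integral => h _.
    rewrite (fubini_tonelli (fun bw => play_round g (h, bw.1, bw.2)))//; last first.
      apply: measurableT_comp mF _; apply: measurable_fun_pair => //.
      by apply: measurable_fun_pair.
    over.
  rewrite (fubini_tonelli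
    (fun hw => \int[bits_law f j]_b play_round g (hw.1, b, hw.2))%E)//.
    apply: (measurable_fun_fubini_tonelli_F
      (fun z : (j.-tuple round * W) * B => play_round g (z.1.1, z.2, z.1.2))) => //.
    apply: measurableT_comp mF _; apply: measurable_fun_pair => //.
      by apply: measurable_fun_pair => //; exact: measurableT_comp.
    exact: measurableT_comp.
  by move=> hw; exact: integral_ge0.
apply: eq_integral => w _; rewrite (ge0_integral_game_lawS (A' w) g0 mg).
rewrite [RHS](eq_measure_integral (game_law A j)); last first.
  by move=> U mU _; exact: lawE.
apply: eq_integral => h _; rewrite ge0_integral_game_kernel//.
apply: eq_integral => b _.
have [cl|cl] := eqVneq (selected (h, b)) (Some l).
  rewrite play_round_eq// cl (eq_measure_integral (\d_(G (h, w)))); last first.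
    by move=> U mU _; exact: A'G.
  rewrite integral_dirac//; first by rewrite diracT mul1e.
  apply: measurableT_comp (mgh h) _; exact: measurable_pair1.
rewrite play_round_neq//; apply: eq_measure_integral => U mU _.
by rewrite AA'// xpair_eqE eqxx.
Qed.

End randomize_one.

End game.

(** * Games with fixed private randomness *)

(* [uniform_prob] lives on [measurableTypeR R], whose display differs from that
   of [R]. *)
Definition uniform01 {R : realType} : set R -> \bar R := uniform_prob (@ltr01 R).

Section uniform01_probability.
Context {R : realType}.

Let uniform01_set0 : @uniform01 R set0 = 0%E. Proof. exact: measure0. Qed.

Let uniform01_ge0 A : (0 <= @uniform01 R A)%E. Proof. exact: measure_ge0. Qed.

Let uniform01_sigma_additive : semi_sigma_additive (@uniform01 R).
Proof. exact: (@measure_semi_sigma_additive _ _ _ (uniform_prob (@ltr01 R))). Qed.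

HB.instance Definition _ := isMeasure.Build _ _ _ (@uniform01 R)
  uniform01_set0 uniform01_ge0 uniform01_sigma_additive.

Let uniform01_setT : @uniform01 R setT = 1%E.
Proof. exact: (@probability_setT _ _ _ (uniform_prob (@ltr01 R))). Qed.

HB.instance Definition _ := Measure_isProbability.Build _ _ _ (@uniform01 R)
  uniform01_setT.

End uniform01_probability.

Section derandomized_game.
Context {R : realType} {k m : nat} {Y : Type} {dB dS : measure_display}
  {B : measurableType dB} {S : measurableType dS}.
Variables (M : contracting_model R k m Y S) (f : selection_mechanism R k B)
  (pi : 'I_k -> agent_policy R Y B S) (y : nat -> Y).

Local Notation round := (B * (R * S))%type.
Local Notation noises := (nat * 'I_k -> R * S).

Definition effort_kernel t (i : 'I_k) : R.-pker t.-tuple round ~> R :=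
  effort (pi i) [tuple y (rev_ord s) | s < t].

Definition respond t i (hw : t.-tuple round * (R * S)) : R * S :=
  (quantile (effort_kernel t i) (hw.1, hw.2.1), hw.2.2).

Lemma measurable_respond t i : measurable_fun setT (respond t i).
Proof.
apply: measurable_fun_pair; last exact: measurableT_comp.
apply: measurableT_comp (measurable_quantile _) _.
by apply: measurable_fun_pair => //; exact: measurableT_comp.
Qed.

Definition noise_law i : probability (R * S)%type R :=
  (uniform01 \x seed_law M i)%E.

(** Inverse transform sampling: the effort is the quantile at a uniform noise, while the seed, whose
    law ignores history and effort, is a noise coordinate left as it is. *)
Lemma respond_law t i h U : measurable U ->
  action_kernel_of M pi y t (Some i) h U =
  noise_law i [set w | U (respond t i (h, w))].
Proof.
move=> mU.
have mg : measurable_fun setT (fun z : R * S => (\1_U z : R)%:E).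
  exact/measurable_EFinP.
have mr : measurable_fun setT (fun w => respond t i (h, w)).
  exact: measurableT_comp (measurable_respond t i) (measurable_pair1 h).
transitivity (\int[action_kernel_of M pi y t (Some i) h]_z (\1_U z)%:E)%E.
  by rewrite (integral_indic _ measurableT mU) setIT.
rewrite [LHS](ge0_integral_pkproduct (effort_kernel t i) (cst_kernel _ (seed_law M i)))//.
rewrite (ge0_integral_randomization uniform01 _
  (fun u => quantile (effort_kernel t i) (h, u))); last 4 first.
- apply: measurableT_comp (measurable_pair1 h); exact: measurable_quantile.
- by move=> A mA; apply: quantile_law => // h'; exact: effort_itv.
- by move=> a; exact: integral_ge0.
- exact: (measurable_fun_fubini_tonelli_F (m2 := seed_law M i) (fun z => (\1_U z)%:E)).
rewrite -(fubini_tonelli1 (m1 := uniform01) (m2 := seed_law M i)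
  (fun w => (\1_U (respond t i (h, w)))%:E))//; last exact: measurableT_comp mg mr.
rewrite -[LHS]/(\int[noise_law i]_w (\1_[set w | U (respond t i (h, w))] w)%:E)%E.
rewrite integral_indic// ?setIT// -[X in measurable X]setTI; exact: mr.
Qed.

(** The value at the outside option is the dummy of [action_kernel_of], so that the two agree
    there. *)
Definition fixed_response (v : noises) t (c : arm k) (h : t.-tuple round) : R * S :=
  if c is Some i then respond t i (h, v (t, i)) else (0, point).

Lemma measurable_fixed_response v t c :
  measurable_fun setT (@fixed_response v t c).
Proof.
case: c => [i|]; last exact: measurable_cst.
exact: measurableT_comp (measurable_respond t i) (measurable_pair2 (v (t, i))).
Qed.

Definition fixed_behavior v t (c : arm k) : R.-pker t.-tuple round ~> (R * S)%type :=
  kdirac (measurable_fixed_response v t c).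

(** Interpolates between the actual play, for empty [s], and the deterministic play, once [s]
    contains every (round, Agent) pair that occurs: the noise is fixed exactly at the pairs of
    [s]. *)
Definition hybrid_behavior (s : seq (nat * 'I_k)) v t (c : arm k) :
    R.-pker t.-tuple round ~> (R * S)%type :=
  if (if c is Some i then (t, i) \in s else true) then fixed_behavior v t c
  else action_kernel_of M pi y t c.

(** * From fixed noises to the actual play *)

Section fixed_le.
Variables (n : nat) (g : n.-tuple round -> \bar R) (C : \bar R).
Hypotheses (g0 : forall h, (0 <= g h)%E) (mg : measurable_fun setT g).

(** Releasing the noise at [p] replaces the value of the game by an average over that noise of
    values bounded by [C]. *)
Let hybrid_cons_le s p :
  (forall v, \int[game_law M f y (hybrid_behavior (p :: s) v) n]_h g h <= C)%E ->
  (forall v, \int[game_law M f y (hybrid_behavior s v) n]_h g h <= C)%E.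
Proof.
case: p => j l sC v.
have [js|js] := boolP ((j, l) \in s).
  rewrite (eq_measure_integral
    (game_law M f y (hybrid_behavior ((j, l) :: s) v) n)) => [|U mU _].
    exact: sC.
  apply: game_law_ext => // t [i|] h V _ mV; rewrite /hybrid_behavior// inE.
  by case: eqVneq => [->|]//=; rewrite js.
(* The released noise [w] is written into [v] at the single pair [(j, l)], which is outside [s]. *)
rewrite (integral_game_randomize _ _ _ (noise_law l) _
  (fun w => hybrid_behavior ((j, l) :: s) [eta v with (j, l) |-> w]) j l
  (respond j l))//.
- by apply: ge0_integral_le_cst => w; rewrite sC integral_ge0.
- exact: measurable_respond.
- by move=> h U mU; rewrite /hybrid_behavior (negbTE js); exact: respond_law.
- by move=> w h U mU; rewrite /hybrid_behavior inE eqxx/= /kdirac/= eqxx.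
- move=> w t [i|] h U; rewrite ?/hybrid_behavior//.
  rewrite xpair_eqE (inj_eq (@Some_inj _)) -xpair_eqE inE => /negbTE til mU.
  by rewrite til/=; case: ifP => // _; rewrite /= /kdirac/= til.
Qed.

(** Only the finitely many pairs with a round before [n] matter; starting with all of them fixed,
    they are released one at a time. *)
Lemma play_law_le :
  (forall v, \int[game_law M f y (fixed_behavior v) n]_h g h <= C)%E ->
  (\int[play_law M f pi y n]_h g h <= C)%E.
Proof.
move=> vC.
suff /(_ (fun=> (0, point))) : forall v,
    (\int[game_law M f y (hybrid_behavior [::] v) n]_h g h <= C)%E.
  rewrite (eq_measure_integral (play_law M f pi y n)) => [//|U mU _].
  apply: trajectory_law_ext => // t h V _ mV.
  apply: eq_integral => b _; apply: eq_measure_integral => W mW _.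
  rewrite -[RHS]/(action_kernel_of M pi y t (selected M f y (h, b)) h W).
  by rewrite -[LHS]/(hybrid_behavior [::] (fun=> (0, point)) t (selected M f y (h, b)) h W)
    /hybrid_behavior; case: (selected _ _ _ _).
pose s := [seq (t, i) | t <- iota 0 n, i <- enum 'I_k].
have : forall v, (\int[game_law M f y (hybrid_behavior s v) n]_h g h <= C)%E.
  move=> v; rewrite (eq_measure_integral (game_law M f y (fixed_behavior v) n)).
    exact: vC.
  move=> U mU _; apply: game_law_ext => // t c h V tn mV.
  rewrite /hybrid_behavior; case: c => [i|]//.
  by rewrite allpairs_f// ?mem_enum// mem_iota.
elim: s => // p s IHs sC; apply: IHs; exact: hybrid_cons_le sC.
Qed.

End fixed_le.

Fixpoint fixed_run (v : noises) t : t.-tuple B -> t.-tuple round :=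
  match t return t.-tuple B -> t.-tuple round with
  | 0 => fun _ => [tuple]
  | t'.+1 => fun bs =>
      let h := fixed_run v t' [tuple of behead bs] in
      let b := thead bs in
      [tuple of (b, fixed_response v t' (selected M f y (h, b)) h) :: h]
  end.

Lemma measurable_fixed_run v t : measurable_fun setT (@fixed_run v t).
Proof.
elim: t => [|t IHt]; first exact: measurable_cst.
have mh : measurable_fun setT
    (fun bs : t.+1.-tuple B => fixed_run v t [tuple of behead bs]).
  by apply: measurableT_comp IHt _; exact: measurable_behead.
have mb : measurable_fun setT (fun bs : t.+1.-tuple B => thead bs).
  exact: measurable_tnth.
apply: measurable_cons => //; apply: measurable_fun_pair => //.
apply: (measurable_arm_case
  (c := fun bs : t.+1.-tuple B =>
     selected M f y (fixed_run v t [tuple of behead bs], thead bs))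
  (g := fun c bs => fixed_response v t c (fixed_run v t [tuple of behead bs]))).
  apply: measurableT_comp (measurable_selected M f y t) _.
  exact: measurable_fun_pair.
by move=> c; apply: measurableT_comp (measurable_fixed_response v t c) _.
Qed.

(** Dirac responses integrate to evaluations, so only the bits of the Principal remain random. *)
Lemma integral_fixed_behavior v n (g : n.-tuple round -> \bar R) :
  (forall h, 0 <= g h)%E -> measurable_fun setT g ->
  (\int[game_law M f y (fixed_behavior v) n]_h g h =
   \int[random_bits_law f n]_bs g (fixed_run v n bs))%E.
Proof.
elim: n g => [|n IHn] g g0 mg.
  rewrite [LHS]integral_dirac// [RHS]integral_dirac//.
  by apply: measurableT_comp mg _; exact: measurable_fixed_run.
have mgh (h : n.-tuple round) :
    measurable_fun setT (fun r : round => g [tuple of r :: h]).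
  apply: measurableT_comp mg _; exact: measurable_cons.
rewrite (ge0_integral_game_lawS M f y _ g0 mg).
rewrite IHn; last 2 first.
- by move=> h; exact: integral_ge0.
- exact: measurable_integral_game_kernel.
rewrite [RHS](ge0_integral_extend_law (random_bits_law f n)
  (cst_kernel _ (bits_law f n)))//; last first.
  by apply: measurableT_comp mg _; exact: measurable_fixed_run.
apply: eq_integral => bs _.
rewrite ge0_integral_game_kernel//.
apply: eq_integral => b _.
rewrite integral_dirac//.
  rewrite diracT mul1e /=; congr (g _).
  by rewrite (_ : [tuple of behead [tuple of b :: bs]] = bs) ?theadE//; exact: val_inj.
apply: measurableT_comp (mgh (fixed_run v n bs)) _; exact: measurable_pair1.
Qed.

Lemma principal_return_bound t h (s : 'I_t) :
  -1 <= (tnth (principal_transcript M f y h) s).2 <= 1.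
Proof.
elim: t h s => [h []//|t IHt] h s.
case: (unliftP ord0 s) => [s' ->|->]; last first.
  rewrite tnth0 /=; case: (select _ _) => [i|] /=; first exact: outcome_return_bound.
  by rewrite lerN10 ler01.
by rewrite /= tnthS; exact: IHt.
Qed.

(** * The adaptive adversary induced by fixed noises *)

Section fixed_adversary.
Variable v : noises.

(** The past play is recomputed from the bits recorded in the transcript. The noise being fixed, the
    loss is also defined for arms not selected: it is the negated return the arm would yield if
    chosen. *)
Definition fixed_loss t (h : t.-tuple (arm k * R * B)) (c : arm k) : R :=
  - realized_return M y t c
      (fixed_response v t c (fixed_run v t [tuple of map snd h])).

Lemma measurable_fixed_loss t c : measurable_fun setT (fun h => @fixed_loss t h c).
Proof.
apply: measurableT_comp => //.
apply: measurableT_comp (measurable_realized_return M y t c) _.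
apply: measurableT_comp (measurable_fixed_response v t c) _.
apply: measurableT_comp (measurable_fixed_run v t) _.
apply/measurable_fun_tnthP => s.
rewrite (_ : _ \o _ = snd \o (fun h : t.-tuple (arm k * R * B) => tnth h s)).
  apply: measurableT_comp => //; exact: measurable_tnth.
by apply/funext => h /=; rewrite tnth_map.
Qed.

Lemma fixed_loss_bound t h c : -1 <= @fixed_loss t h c <= 1.
Proof.
rewrite /fixed_loss lerNl opprK lerNl andbC; case: c => [i|] /=.
  exact: outcome_return_bound.
by rewrite lerN10 ler01.
Qed.

Lemma fixed_loss_outside t h : @fixed_loss t h None = 0.
Proof. by rewrite /fixed_loss /= oppr0. Qed.

Definition fixed_adversary : adversary R k B :=
  Adversary measurable_fixed_loss fixed_loss_bound fixed_loss_outside.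

Lemma bandit_run_bits t (bs : t.-tuple B) :
  map snd (bandit_run f fixed_adversary bs) = bs.
Proof.
elim: t bs => [|t IHt] bs; first by rewrite [bs]tuple0.
by rewrite /= IHt [in RHS](tuple_eta bs).
Qed.

(** By induction the mechanism sees the same transcript in both runs and selects the same arm, and
    the adversary, recovering the bits, returns the negation of the realized return. *)
Lemma bandit_run_transcript t (bs : t.-tuple B) :
  map (@as_return R k dB B) (bandit_run f fixed_adversary bs) =
  principal_transcript M f y (fixed_run v t bs).
Proof.
elim: t bs => [//|t IHt] bs.
have bitsE : [tuple of map snd [tuple of map (@observed R k dB B)
    (bandit_run f fixed_adversary [tuple of behead bs])]] = [tuple of behead bs].
  by apply/val_inj; rewrite /= -map_comp -[RHS]bandit_run_bits.
have transE : [tuple of map (@as_return R k dB B)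
    (bandit_run f fixed_adversary [tuple of behead bs])] =
    principal_transcript M f y (fixed_run v t [tuple of behead bs]).
  by apply/val_inj; exact: IHt.
have behE (x : round) (h : t.-tuple round) : [tuple of behead [tuple of x :: h]] = h.
  exact: val_inj.
by rewrite /= /as_return /= transE /fixed_loss bitsE behE /= opprK -IHt.
Qed.

Lemma bandit_run_loss_outside t (bs : t.-tuple B) (s : 'I_t) :
  (tnth (bandit_run f fixed_adversary bs) s).1.2 None = 0.
Proof.
elim: t bs s => [bs []//|t IHt] bs s.
case: (unliftP ord0 s) => [s' ->|->]; last exact: fixed_loss_outside.
by rewrite /= tnthS; exact: IHt.
Qed.

End fixed_adversary.

(** Minus the cumulative return of Agent [i]. It is read off the transcript of the Principal, which
    the game and the bandit run share. *)
Definition agent_loss {t} (i : 'I_k) (p : t.-tuple (arm k * R)) : R :=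
  \sum_(s < t | (tnth p s).1 == Some i) - (tnth p s).2.

Lemma measurable_agent_loss t i : measurable_fun setT (@agent_loss t i).
Proof.
rewrite (_ : agent_loss i = fun p => \sum_(s < t)
    (if (tnth p s).1 == Some i then - (tnth p s).2 else 0)); last first.
  by apply/funext => p; rewrite /agent_loss big_mkcond.
apply: measurable_sum => s.
apply: (measurable_arm_case (c := fun p : t.-tuple (arm k * R) => (tnth p s).1)
  (g := fun c p => if c == Some i then - (tnth p s).2 else 0)).
  apply: measurableT_comp => //; exact: measurable_tnth.
move=> c; case: (c == Some i) => //.
apply: measurableT_comp => //; apply: measurableT_comp => //.
exact: measurable_tnth.
Qed.

Lemma agent_loss_bound t i h :
  `|agent_loss i (principal_transcript M f y (t := t) h)| <= t%:R.
Proof.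
apply: (le_trans (ler_norm_sum _ _ _)).
rewrite -[X in _ <= X%:R]card_ord -sum1_card natr_sum.
rewrite [leLHS]big_mkcond/=; apply: ler_sum => s _.
case: ifP => // _; rewrite normrN ler_norml.
exact: principal_return_bound.
Qed.

(** The left side is the term of the maximum at [chi]: a round with arm [Some i] contributes its
    loss minus the zero loss of [None], and any other round contributes zero. *)
Lemma fixed_swap_regret v t i :
  ('E_(random_bits_law f t)[fun bs =>
     agent_loss i (principal_transcript M f y (fixed_run v t bs))] <=
   swap_regret f (fixed_adversary v) t)%E.
Proof.
pose chi : {ffun arm k -> arm k} :=
  [ffun a : arm k => if a == Some i then None else a].
rewrite /swap_regret (bigD1 chi)//= le_max; apply/orP; left.
rewrite le_eqVlt; apply/orP; left; apply/eqP; congr expectation.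
apply/funext => bs; rewrite /agent_loss big_mkcond; apply: eq_bigr => s _.
rewrite (_ : principal_transcript M f y (fixed_run v t bs) =
  [tuple of map (@as_return R k dB B) (bandit_run f (fixed_adversary v) bs)]); last first.
  by apply/val_inj; rewrite /= bandit_run_transcript.
rewrite tnth_map; have := bandit_run_loss_outside v _ bs s.
case: (tnth _ s) => -[a l] b /= l0; rewrite opprK ffunE.
by case: eqP => _; rewrite ?l0 ?subr0 ?subrr.
Qed.

End derandomized_game.

(** * Bounded random variables and the payment bound *)

Section bounded_expectation.
Context {d : measure_display} {W : measurableType d} {R : realType}.
Variables (P : probability W R) (X : W -> R) (c : R).
Hypotheses (mX : measurable_fun setT X) (Xc : forall w, `|X w| <= c).

Lemma bounded_integrable : P.-integrable setT (EFin \o X).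
Proof.
apply: measurable_bounded_integrable => //.
  by rewrite -ge0_fin_numE// fin_num_measure.
exists c; split; first exact: num_real.
by move=> e ce w _; exact: le_trans (Xc w) (ltW ce).
Qed.

Lemma bounded_expectation_shift :
  (\int[P]_w (c + X w)%:E = c%:E + 'E_P[X])%E.
Proof.
rewrite unlock; under eq_integral do rewrite EFinD.
rewrite integralD//; first by rewrite integral_probability_cst.
  exact: finite_measure_integrable_cst.
exact: bounded_integrable.
Qed.

End bounded_expectation.

Theorem lemma12 (R : realType) (k m : nat) (Y : Type)
    (dB dS : measure_display) (B : measurableType dB) (S : measurableType dS)
    (M : contracting_model R k m Y S)
    (f : selection_mechanism R k B)
    (SReg : nat -> R) (T : nat) (alpha : R)
    (hf : forall adv : adversary R k B, (swap_regret f adv T <= (SReg T)%:E)%E)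
    (halpha : 0 <= alpha <= 1)
    (pi : 'I_k -> agent_policy R Y B S) (y : nat -> Y) (i : 'I_k) :
  ((- (alpha * SReg T))%:E <=
    'E_(play_law M f pi y T)[cumulative_payment M f y alpha i (T := T)])%E.
Proof.
pose loss h := agent_loss i (principal_transcript M f y (t := T) h).
have mloss : measurable_fun setT loss.
  apply: measurableT_comp (measurable_agent_loss T i) _.
  exact: measurable_principal_transcript.
have lossT h : `|loss h| <= T%:R by exact: agent_loss_bound.
(* Adding [T%:R], a bound on the absolute loss, makes the integrand nonnegative, as [play_law_le]
   requires. *)
have shifted_le :
    (\int[play_law M f pi y T]_h (T%:R + loss h)%:E <= (T%:R + SReg T)%:E)%E.
  have g0 h : (0 <= (T%:R + loss h)%:E)%E.
    by rewrite lee_fin -lerBlDl sub0r; move: (lossT h); rewrite ler_norml => /andP[].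
  have mg : measurable_fun setT (fun h => (T%:R + loss h)%:E).
    by apply/measurable_EFinP; exact: measurable_funD.
  (* For each [v] the play is a bandit run against [fixed_adversary v], to which [hf] applies. *)
  apply: play_law_le => // v; rewrite integral_fixed_behavior//.
  rewrite (bounded_expectation_shift _ (loss \o fixed_run M f pi y v T))//.
    by rewrite EFinD leeD2l// (le_trans (fixed_swap_regret M f pi y v T i)).
    exact: measurableT_comp mloss (measurable_fixed_run M f pi y v T).
  by move=> bs; exact: lossT.
have intloss := bounded_integrable (play_law M f pi y T) loss _ mloss lossT.
have loss_le : ('E_(play_law M f pi y T)[loss] <= (SReg T)%:E)%E.
  by move: shifted_le; rewrite (bounded_expectation_shift _ loss)// EFinD leeD2lE.
rewrite (_ : cumulative_payment _ _ _ _ _ (T:=T) = fun h => - alpha * loss h); last first.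
  apply/funext => h; rewrite /cumulative_payment /loss /agent_loss.
  by rewrite mulr_sumr; apply: eq_bigr => s _; rewrite mulrNN.
move: loss_le; rewrite unlock => loss_le.
under eq_integral do rewrite EFinM.
(* The factor [- alpha] turns the upper bound on the loss into a lower bound on the payment, as
   [alpha] is nonnegative. *)
rewrite integralZl// !EFinN mulNe leeN2 EFinM lee_wpmul2l//.
by case/andP: halpha.
Qed.
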